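(* In each of the following pairs (rooted graph, subgroup of $S_4$), the graph and the group have the same algebraic invariants, i.e. the same sequence $(c_k)_{k\ge0}$ (equivalently the same spectral measure $\mu$, equivalently the same circular measure $\varepsilon$): $$\tilde A_1\leftrightarrow\mathbb{Z}_1,\quad \tilde A_3\leftrightarrow\mathbb{Z}_2,\quad \tilde A_5\leftrightarrow\mathbb{Z}_3,\quad \tilde A_7\leftrightarrow V,\quad \tilde D_4\leftrightarrow\mathbb{Z}_4,$$ $$\tilde D_6\leftrightarrow D_4,\quad \tilde\Delta_6\leftrightarrow D_1,\quad \tilde\Delta_7\leftrightarrow S_3,\quad \tilde E_6\leftrightarrow A_4,\quad \tilde E_7\leftrightarrow S_4.$$
   Context: Algebraic invariants of a subgroup $G\subset S_4$: $c_k$ is the multiplicity of the trivial representation in $u^{\otimes k}$, where $u$ is the permutation representation of $G$ on $\mathbb{C}^4$. Algebraic invariants of a rooted graph of norm $\le2$: $c_k$ is the number of loops of length $2k$ based at the root (multiple edges counted with multiplicity). In both cases $\mu$ is the probability measure on $[0,4]$ having the $c_k$ as moments, and $\varepsilon$ is the probability measure on the unit circle obtained by pulling back $\mu$ via $\varphi(q)=(q+\bar q)^2$, the mass at $x\in[0,4]$ being distributed uniformly among the preimages $\varphi^{-1}(x)$. Subgroups of $S_4$ (acting on 4 points): $\mathbb{Z}_1$ trivial; $\mathbb{Z}_2$ of order 2, whose non-trivial element has no fixed point; $D_1$ of order 2, whose non-trivial element has 2 fixed points; $\mathbb{Z}_3$ of order 3; $\mathbb{Z}_4$ cyclic of order 4;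 $V$ the Klein group in which exactly 2 non-trivial elements have 2 fixed points, e.g. $\{1,(12),(34),(12)(34)\}$; $S_3$ a point stabilizer; $D_4$ of order 8; $A_4$; $S_4$. Rooted graphs: $\tilde A_{2n-1}$ is the cycle with $2n$ vertices ($\tilde A_1$ being two vertices joined by a double edge), rooted at any vertex. $\tilde D_4$ is a vertex with four leaves attached, rooted at a leaf. $\tilde D_6$ is a path $x_1-x_2-x_3$ with two leaves attached to $x_1$ and two leaves attached to $x_3$, rooted at a leaf; $\tilde\Delta_6$ is the same graph rooted at $x_1$. $\tilde E_6$ is the star-shaped tree with a central vertex and three arms of 2 further vertices each, rooted at the end of an arm. $\tilde E_7$ is the star-shaped tree with a central vertex and three arms having 1, 3, 3 further vertices, rooted at the end of an arm with 3 vertices; $\tilde\Delta_7$ is the same graph rooted at the neighbour of the end vertex of an arm with 3 vertices. *)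

(* Defs.v *)
From mathcomp Require Import all_boot all_order all_algebra all_fingroup.
From mathcomp Require Import all_solvable all_character.
From mathcomp Require Import all_classical all_reals all_analysis.
From mathcomp.real_closed Require Import complex.

Set Implicit Arguments.
Unset Strict Implicit.
Unset Printing Implicit Defensive.

Import Order.TTheory GRing.Theory Num.Theory.

Local Open Scope ring_scope.

Section Representations.

Variables (F : decFieldType) (gT : finGroupType) (G : {group gT}).

Lemma trivial_mx_repr : mx_repr G (fun _ : gT => 1%:M : 'M[F]_1).
Proof. by split=> // g h _ _; rewrite mulmx1. Qed.

Definition trivial_grepr : representation F G :=
  Representation (MxRepresentation trivial_mx_repr).

Fixpoint tensor_power (u : representation F G) (k : nat) : representation F G :=
  if k is k'.+1 then Representation (prod_repr u (tensor_power u k'))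
  else trivial_grepr.

(* [DecSocleType V] indexes the isotypic components W of V, [socle_repr W] is
   the simple representation of type W, and [socle_mult W] is its
   multiplicity; at most one W contributes to the sum. *)
Definition trivial_multiplicity (V : representation F G) : nat :=
  \sum_(W : DecSocleType V | `[< mx_rsim (socle_repr W) trivial_grepr >])
     socle_mult W.

End Representations.

Section PermutationGroups.

Lemma permutation_mx_repr (F : fieldType) (n : nat) (G : {group 'S_n}) :
  mx_repr G (fun g : 'S_n => perm_mx g : 'M[F]_n).
Proof. by split=> [|g h _ _]; rewrite ?perm_mx1 ?perm_mxM. Qed.

Definition permutation_grepr (F : fieldType) (n : nat) (G : {group 'S_n}) :
    representation F G :=
  Representation (MxRepresentation (@permutation_mx_repr F n G)).

Definition group_invariant (R : realType) (G : {group 'S_4}) (k : nat) : nat :=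
  trivial_multiplicity (tensor_power (permutation_grepr R[i] G) k).

Definition num_fixed (g : 'S_4) : nat := #|[set i | g i == i]|.

Definition is_Z1 (G : {group 'S_4}) : Prop := G :=: 1%g.

Definition is_Z2 (G : {group 'S_4}) : Prop :=
  #|G| = 2%N /\ {in (G^#)%g, forall g, num_fixed g = 0%N}.

Definition is_D1 (G : {group 'S_4}) : Prop :=
  #|G| = 2%N /\ {in (G^#)%g, forall g, num_fixed g = 2%N}.

Definition is_Z3 (G : {group 'S_4}) : Prop := #|G| = 3%N.

Definition is_Z4 (G : {group 'S_4}) : Prop := cyclic G /\ #|G| = 4%N.

Definition is_V (G : {group 'S_4}) : Prop :=
  [/\ (2.-abelem G)%g, #|G| = 4%N & #|[set g in (G^#)%g | num_fixed g == 2%N]| = 2%N].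

Definition is_S3 (G : {group 'S_4}) : Prop :=
  exists i : 'I_4, G :=: [set g : 'S_4 | g i == i].

Definition is_D4 (G : {group 'S_4}) : Prop := #|G| = 8%N.

Definition is_A4 (G : {group 'S_4}) : Prop := G :=: ('Alt_('I_4))%g.

Definition is_S4 (G : {group 'S_4}) : Prop := G :=: [set: 'S_4].

End PermutationGroups.

Section Graphs.

(* Multiple edges are allowed, since edges form a type of their own. *)
Record multigraph := Multigraph {
  vertex : finType;
  edge : finType;
  ends : edge -> vertex * vertex
}.

Variable X : multigraph.

(* A dart is an edge together with a direction of travel. *)
Definition dart : finType := (edge X * bool)%type.
Definition source (d : dart) : vertex X :=
  if d.2 then (ends d.1).2 else (ends d.1).1.
Definition target (d : dart) : vertex X :=
  if d.2 then (ends d.1).1 else (ends d.1).2.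

Fixpoint is_walk (x y : vertex X) (w : seq dart) : bool :=
  if w is d :: w' then (source d == x) && is_walk (target d) y w' else x == y.

Definition num_loops (x : vertex X) (n : nat) : nat :=
  #|[set w : n.-tuple dart | is_walk x x w]|.

Definition graph_invariant (x : vertex X) (k : nat) : nat :=
  num_loops x (2 * k).

Definition leaf (x : vertex X) : bool := #|[set d : dart | source d == x]| == 1%N.

End Graphs.

(* The cycle on m vertices; for m = 2 the two edges form a double edge. *)
Definition cycle_graph (m : nat) : multigraph :=
  @Multigraph 'I_m 'I_m (fun i => (i, ordS i)).

Definition Atilde (n : nat) : multigraph := cycle_graph n.+1.

(* The graph on the vertices 0, ..., n with the listed edges; every number
   in the list must be at most n. *)
Definition graph_of_edges (n : nat) (s : seq (nat * nat)) : multigraph :=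
  @Multigraph 'I_n.+1 'I_(size s)
    (fun e => let p := nth (0%N, 0%N) s e in (inord p.1, inord p.2)).

Definition Dtilde4 : multigraph :=
  graph_of_edges 4 [:: (0, 1); (0, 2); (0, 3); (0, 4)]%N.

(* The path is 0 - 1 - 2. *)
Definition Dtilde6 : multigraph :=
  graph_of_edges 6 [:: (0, 1); (1, 2); (0, 3); (0, 4); (2, 5); (2, 6)]%N.

(* The centre is 0 and the arms are 1 - 2, 3 - 4 and 5 - 6. *)
Definition Etilde6 : multigraph :=
  graph_of_edges 6 [:: (0, 1); (1, 2); (0, 3); (3, 4); (0, 5); (5, 6)]%N.

(* The centre is 0 and the arms are 1, 2 - 3 - 4 and 5 - 6 - 7. *)
Definition Etilde7 : multigraph :=
  graph_of_edges 7
    [:: (0, 1); (0, 2); (2, 3); (3, 4); (0, 5); (5, 6); (6, 7)]%N.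

Section Measures.

Variable R : realType.

Local Open Scope classical_set_scope.

Definition is_spectral_measure (c : nat -> nat) (mu : probability R R) : Prop :=
  mu `[0, 4] = 1%E /\
  forall k, (\int[mu]_x (x ^+ k)%:E = (c k)%:R%:E)%E.

(* The complex plane is R * R, with its product (that is, Borel) sigma-algebra;
   [to_complex] identifies it with R[i]. *)
Definition to_complex (z : R * R) : R[i] := (z.1 +i* z.2)%C.

Definition unit_circle : set (R * R) := [set z | `|to_complex z| = 1].

Definition phi (z : R * R) : R :=
  complex.Re ((to_complex z + (to_complex z)^*) ^+ 2).

Definition fiber (x : R) : set (R * R) := unit_circle `&` phi @^-1` [set x].

(* The mass at x is distributed uniformly over the finite set [fiber x]: the
   fraction given to A is the proportion of points of [fiber x] lying in A. *)
Definition is_pullback (mu : probability R R) (eps : probability (R * R)%type R) :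
    Prop :=
  eps unit_circle = 1%E /\
  forall A, measurable A ->
    (eps A = \int[mu]_(x in `[0%R, 4%R])
       (fine (counting (A `&` fiber x) : \bar R)
          / fine (counting (fiber x) : \bar R))%:E)%E.

Definition is_circular_measure (c : nat -> nat)
    (eps : probability (R * R)%type R) : Prop :=
  exists2 mu, is_spectral_measure c mu & is_pullback mu eps.

(* "The measure described by P is the measure described by Q": both exist, and
   any two are equal, which also makes each of them unique. *)
Definition same_measure d (T : measurableType d) (P Q : probability T R -> Prop) :
    Prop :=
  [/\ exists m, P m, exists m, Q m &
      forall m m', P m -> Q m' -> forall A, measurable A -> m A = m' A].

Definition same_invariants (X : multigraph) (x : vertex X) (G : {group 'S_4}) :
    Prop :=
  let c := graph_invariant x in
  let c' := group_invariant R G in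
  [/\ forall k, c k = c' k,
      same_measure (is_spectral_measure c) (is_spectral_measure c') &
      same_measure (is_circular_measure c) (is_circular_measure c')].

End Measures.

(* Main.v *)
Require Import Defs.
From HB Require Import structures.
From mathcomp Require Import all_boot all_order all_algebra all_fingroup.
From mathcomp Require Import all_solvable all_character.
From mathcomp Require Import all_classical all_reals all_analysis.
From mathcomp Require Import measurable_realfun.
From mathcomp.real_closed Require Import complex.
From mathcomp Require Import zify ring lra.

(** For a group G, averaging over G projects onto the invariant vectors, so that
    |G| c_k is the sum over g in G of fix(g)^k, where fix(g) lies in
    {0, 1, 2, 4}.  Hence (c_k) satisfies the linear recurrence attached to
    t(t-1)(t-2)(t-4), and mu is the mean of the Dirac masses at the fix(g).
    For a graph with adjacency operator A, one checks that
    t(t-1)(t-2)(t-4) evaluated at A^2 kills the indicator of the root, so the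
    loop counts satisfy the same recurrence, and it is enough to compare
    c_0, ..., c_3.  The measure mu is determined by its moments because a
    nonnegative polynomial vanishing exactly on its finite support has integral
    0, and eps is the mean of the images of mu under the four maps
    x |-> (+- sqrt(x)/2, +- sqrt(1 - x/4)). *)

Set Implicit Arguments.
Unset Strict Implicit.
Unset Printing Implicit Defensive.

Import Order.TTheory GRing.Theory Num.Theory.

(** * Invariant vectors *)

Section InvariantVectors.
Local Open Scope ring_scope.

(** In the rank factorization [P = C R], idempotence lets [C] be cancelled on the left and [R] on
    the right, so [R C = 1]; and [C R] and [R C] have the same trace. *)
Lemma mxtrace_idem (F : fieldType) n (P : 'M[F]_n) :
  P *m P = P -> \tr P = (\rank P)%:R.
Proof.
move=> idP; have RC1 : row_base P *m col_base P = 1%:M.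
  apply: (row_full_inj (col_base_full P)); apply: (row_free_inj (row_base_free P)).
  by rewrite mulmx1 mulmxA mulmx_base -mulmxA mulmx_base.
by rewrite -{1}(mulmx_base P) mxtrace_mulC RC1 mxtrace1.
Qed.

Section FixedVectors.

Variables (F : decFieldType) (gT : finGroupType) (G : {group gT}).

(** The mean [P] of the [rG g] is an idempotent whose row space is the fixed space, so its trace is
    the dimension of that space. *)
Lemma mxtrace_rfix n (rG : mx_representation F G n) :
    #|G|%:R != 0 :> F ->
  \sum_(g in G) \tr (rG g) = (#|G| * \rank (rfix_mx rG G))%:R.
Proof.
move=> G_neq0; pose P := #|G|%:R^-1 *: \sum_(g in G) rG g.
have fixP m (W : 'M[F]_(m, n)) : (W <= rfix_mx rG G)%MS -> W *m P = W.
  move/rfix_mxP => fixW; rewrite /P -scalemxAr mulmx_sumr (eq_bigr (fun=> W)) //.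
  by rewrite sumr_const -scaler_nat scalerA mulVf ?scale1r.
have fixr g : g \in G -> P *m rG g = P.
  move=> Gg; rewrite /P -scalemxAl; congr (_ *: _).
  rewrite mulmx_suml (reindex_inj (mulIg g^-1)%g) /=.
  apply: eq_big => [h|h Gh]; first by rewrite groupMr ?groupV.
  by rewrite -repr_mxM ?mulgKV -?(groupMr h (groupVr Gg)).
have eqP : (P :=: rfix_mx rG G)%MS.
  apply/eqmxP/andP; split; first exact/rfix_mxP.
  by rewrite -{1}(fixP _ (rfix_mx rG G)) ?submxMl.
have idP : P *m P = P by apply: fixP; rewrite eqP.
rewrite natrM -eqP -mxtrace_idem // /P mxtraceZ mulrA divff // mul1r.
by rewrite raddf_sum.
Qed.

Lemma submod_repr_trivial n (rG : mx_representation F G n) U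
    (modU : mxmodule rG U) :
  mx_rsim (submod_repr modU) (trivial_grepr F G) <->
  (U <= rfix_mx rG G)%MS /\ \rank U = 1%N.
Proof.
rewrite -rfix_mx_rstabC // -(rker_submod modU); split=> [simU | [fixU rkU]].
  split; last by have [] := simU.
  apply/fintype.subsetP => g Gg; rewrite inE Gg mul1mx; apply/eqP.
  exact: (mx_rsim_scalar Gg (mx_rsim_sym simU)).
exists (const_mx 1) => // [|g Gg].
  rewrite /row_free rkU eqn_leq rank_leq_col lt0n mxrank_eq0.
  by apply/matrix0Pn; exists 0, 0; rewrite mxE oner_eq0.
have := fintype.subsetP fixU g Gg.
by rewrite inE Gg mul1mx mulmx1 => /eqP ->; rewrite mul1mx.
Qed.

Lemma fixed_row_simple n (rG : mx_representation F G n) (v : 'rV_n) :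
    v != 0 -> (v <= rfix_mx rG G)%MS ->
  mxsimple rG <<v>>%MS /\ \rank <<v>> = 1%N.
Proof.
move=> nz_v fixv; have rkv : \rank <<v>> = 1%N by rewrite genmxE rank_rV nz_v.
split=> //; apply: linear_mxsimple rkv; apply/mxmoduleP => g Gg.
by rewrite (eqmxMr _ (genmxE v)) (rfix_mxP _ fixv) ?genmxE.
Qed.

(** Every nonzero fixed vector spans a simple submodule of trivial type, so a component of trivial
    type is the whole fixed space. Hence there is at most one, and since its simple type has degree
    1 its multiplicity is its rank. If there is none, no nonzero vector is fixed. *)
Lemma trivial_multiplicity_rfix (V : representation F G) :
  trivial_multiplicity V = \rank (rfix_mx V G).
Proof.
set sV := DecSocleType V; set T := trivial_grepr F G.
have compP (W : sV) : mx_rsim (socle_repr W) T -> (W :=: rfix_mx V G)%MS.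
  move=> WT; have [fixW rkW] := (submod_repr_trivial (socle_module W)).1 WT.
  apply/eqmxP/andP; split.
    have [I [U isoU defW]] := component_mx_def (socle_simple W).
    rewrite /socle_val defW; apply/sumsmx_subP => i _.
    have [f _ hom_f <-] := isoU i.
    by apply/rfix_mxP => g Gg; rewrite -(hom_mxP hom_f) // (rfix_mxP G _).
  apply/row_subP => i; set v := row i _.
  have [-> | nz_v] := eqVneq v 0; first exact: sub0mx.
  have fixv : (v <= rfix_mx V G)%MS by apply: row_sub.
  have [simv rkv] := fixed_row_simple nz_v fixv.
  rewrite -(genmxE v); apply: (mx_iso_component (socle_simple W)).
  apply/(mx_rsim_iso (socle_module W) (mxsimple_module simv)).
  apply: mx_rsim_trans WT (mx_rsim_sym _).
  by apply/submod_repr_trivial; rewrite genmxE.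
have [W0 /asboolP W0P | noW] :=
    pickP (fun W : sV => `[< mx_rsim (socle_repr W) T >]).
  rewrite /trivial_multiplicity (big_pred1 W0) => [|W].
    have [_ rkW] := (submod_repr_trivial (socle_module W0)).1 W0P.
    by rewrite /socle_mult rkW divn1 (compP _ W0P).
  apply/asboolP/eqP => [WP | -> //]; apply/socleP.
  by rewrite !(compP _ W0P) !(compP _ WP) submx_refl.
rewrite /trivial_multiplicity big_pred0 //; apply/esym/eqP; rewrite mxrank_eq0.
apply/rowV0P => v fixv; apply/eqP/negP => /negP nz_v.
have [simv rkv] := fixed_row_simple nz_v fixv.
have [W _ isoW] := subSocle_iso simv (simple_Socle sV simv).
have /asboolP[] := negbT (noW W).
apply: (mx_rsim_trans (rG2 := submod_repr (mxsimple_module simv))).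
  by apply/mx_rsim_iso.
by apply/submod_repr_trivial; rewrite genmxE.
Qed.

End FixedVectors.

Lemma mxtrace_tensor_power (F : decFieldType) (gT : finGroupType)
    (G : {group gT}) (u : representation F G) k g :
  \tr (tensor_power u k g) = \tr (u g) ^+ k.
Proof. by elim: k => [|k IH]; rewrite ?mxtrace1 // exprS -IH -mxtrace_prod. Qed.

Lemma mxtrace_perm (F : fieldType) n (s : 'S_n) :
  \tr (perm_mx s : 'M[F]_n) = #|[set i | s i == i]|%:R.
Proof.
rewrite /mxtrace cardsE -sum1_card natr_sum [RHS]big_mkcond; apply: eq_bigr => i _.
by rewrite !mxE unfold_in -[eqn _ _]/(s i == i); case: eqP.
Qed.

Lemma group_invariantE (R : realType) (G : {group 'S_4}) k :
  (#|G| * group_invariant R G k = \sum_(g in G) num_fixed g ^ k)%N.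
Proof.
have G_neq0 : #|G|%:R != 0 :> R[i] by rewrite pnatr_eq0 -lt0n cardG_gt0.
apply/eqP; rewrite -(eqr_nat R[i]) /group_invariant trivial_multiplicity_rfix.
rewrite -mxtrace_rfix // natr_sum; apply/eqP; apply: eq_bigr => g _.
by rewrite mxtrace_tensor_power mxtrace_perm natrX.
Qed.

End InvariantVectors.

(** * Walks in graphs *)

Section GraphWalks.

Section Walks.

Variable X : multigraph.
Implicit Types (x y : vertex X) (n : nat).

(** The end [y] is fixed and the start [x] varies, because removing the first dart moves the start.
    As a function of [x] this is [A^n] applied to the indicator of [y]. *)
Definition num_walks y n x : nat := #|[set w : n.-tuple (dart X) | is_walk x y w]|.

Lemma num_walks0 y x : num_walks y 0 x = (x == y).
Proof.
rewrite /num_walks (eq_card (B := fun=> x == y)) => [|w]; last first.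
  by rewrite inE (tuple0 w).
by case: eqP => _; rewrite ?card0 // card_tuple.
Qed.

Lemma num_walksS y n x :
  num_walks y n.+1 x = \sum_(d : dart X | source d == x) num_walks y n (target d).
Proof.
pose cons_pair (p : dart X * n.-tuple (dart X)) : n.+1.-tuple (dart X) :=
  cons_tuple p.1 p.2.
have cons_bij : bijective cons_pair.
  exists (fun w => (thead w, [tuple of behead w])) => [[d w]|w].
    by congr (_, _); apply: val_inj.
  by rewrite [RHS]tuple_eta; apply: val_inj.
rewrite /num_walks -sum1_card (reindex cons_pair); last exact: onW_bij.
under [RHS]eq_bigr do rewrite -sum1_card.
by rewrite pair_big_dep; apply: eq_bigl => -[d w]; rewrite !inE.
Qed.

(** Applying [A] once more preserves a linear relation, provided the relation holds at every vertex.
    The coefficients come from t^4 - 7t^3 + 14t^2 - 8t at t = A^2, with the negative terms moved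
    across to stay in [nat]. *)
Lemma num_walks_recurrence y :
  (forall x, num_walks y 8 x + 14 * num_walks y 4 x =
             7 * num_walks y 6 x + 8 * num_walks y 2 x) ->
  forall n x, num_walks y (8 + n) x + 14 * num_walks y (4 + n) x =
             7 * num_walks y (6 + n) x + 8 * num_walks y (2 + n) x.
Proof.
move=> rec0; elim=> [|n IH] x; first by rewrite !addn0.
by rewrite !addnS !num_walksS !big_distrr -!big_split; apply: eq_bigr => d _.
Qed.

End Walks.

Lemma recurrence_unique (a b : nat -> nat) :
    (forall k, a (4 + k) + 14 * a (2 + k) = 7 * a (3 + k) + 8 * a (1 + k)) ->
    (forall k, b (4 + k) + 14 * b (2 + k) = 7 * b (3 + k) + 8 * b (1 + k)) ->
    (forall k, k < 4 -> a k = b k) ->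
  a =1 b.
Proof.
move=> reca recb ab4 k; have [m lekm] := ubnP k.
elim: m k lekm => // m IH k lekm; have [/ab4 //|ge4k] := ltnP k 4.
have -> : k = 4 + (k - 4) by lia.
have := reca (k - 4); have := recb (k - 4).
have -> := IH (2 + (k - 4)) _; last lia.
have -> := IH (3 + (k - 4)) _; last lia.
have -> := IH (1 + (k - 4)) _; last lia.
lia.
Qed.

(** * Walk counts computed from edge lists *)

Section EdgeLists.

(** One entry per dart leaving [i], so that multiple edges give repeated entries. *)
Definition neighbours (s : seq (nat * nat)) (i : nat) : seq nat :=
  flatten [seq (if p.1 == i then [:: p.2] else [::]) ++
               (if p.2 == i then [:: p.1] else [::]) | p <- s].

Definition walk_step (s : seq (nat * nat)) (v : seq nat) : seq nat :=
  [seq sumn [seq nth 0 v j | j <- neighbours s i] | i <- iota 0 (size v)].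

Definition walk_vector s m j n : seq nat :=
  iter n (walk_step s) [seq nat_of_bool (i == j) | i <- iota 0 m].

(* The first test says that t(t-1)(t-2)(t-4), evaluated at the square of the
   adjacency operator, kills the indicator of the root j; the second compares
   the first four loop counts with the expected ones. *)
Definition spectrum_check s m n2 n1 n0 j : bool :=
  let w := walk_vector s m j in
  all (fun i => nth 0 (w 8) i + 14 * nth 0 (w 4) i ==
                7 * nth 0 (w 6) i + 8 * nth 0 (w 2) i) (iota 0 m) &&
  all (fun k => (1 + n2 + n1 + n0) * nth 0 (w (2 * k)) j ==
                4 ^ k + n2 * 2 ^ k + n1 * 1 ^ k + n0 * 0 ^ k) (iota 0 4).

Variables (X : multigraph) (m : nat) (code : vertex X -> 'I_m) (s : seq (nat * nat)).
Hypothesis code_inj : injective code.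
Hypothesis code_edges :
  [seq (val (code (ends e).1), val (code (ends e).2)) | e <- enum (edge X)] = s.

Lemma sum_neighbours (f : nat -> nat) x :
  \sum_(d : dart X | source d == x) f (code (target d)) =
  \sum_(j <- neighbours s (code x)) f j.
Proof.
rewrite -code_edges /neighbours big_flatten 2!big_map big_enum /=.
rewrite big_mkcond -(pair_bigA _ (fun e b =>
  if source (e, b) == x then f (code (target (e, b))) else 0)).
(* [big_bool] puts the backward dart first and [neighbours] the forward one, hence [addnC]. *)
apply: eq_bigr => e _; rewrite big_bool /= /source /target /= big_cat addnC /=.
rewrite !(inj_eq val_inj) !(inj_eq code_inj).
by congr (_ + _); case: eqP => _; rewrite ?big_nil ?big_cons ?big_nil ?addn0.
Qed.

Lemma size_walk_vector j n : size (walk_vector s m j n) = m.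
Proof. by elim: n => [|n IH]; rewrite /= size_map size_iota. Qed.

Lemma nth_walk_vector y n x :
  nth 0 (walk_vector s m (code y) n) (code x) = num_walks y n x.
Proof.
elim: n x => [|n IH] x.
  rewrite num_walks0 (nth_map 0) ?size_iota // nth_iota // add0n.
  by rewrite (inj_eq val_inj) (inj_eq code_inj).
rewrite num_walksS /= (nth_map 0) ?size_iota ?size_walk_vector //.
rewrite nth_iota // add0n sumnE big_map -sum_neighbours.
by apply: eq_bigr => d _; rewrite IH.
Qed.

Lemma leaf_neighbours x : leaf x = (size (neighbours s (code x)) == 1).
Proof.
rewrite /leaf -sum1_card -sum1_size -sum_neighbours; congr (_ == _).
by apply: eq_bigl => d; rewrite inE.
Qed.

(** The right-hand side obeys the same recurrence because 4, 2, 1 and 0 are the roots of its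
    polynomial, so four values decide. Since [0 ^ 0 = 1], the last term contributes at [k = 0]
    only. *)
Lemma graph_invariant_check n2 n1 n0 x :
    spectrum_check s m n2 n1 n0 (code x) ->
  forall k, (1 + n2 + n1 + n0) * graph_invariant x k =
            4 ^ k + n2 * 2 ^ k + n1 * 1 ^ k + n0 * 0 ^ k.
Proof.
case/andP => /allP rec0 /allP init; apply: recurrence_unique => [k|k|k ltk4].
- have invE j : graph_invariant x (j + k) = num_walks x (2 * j + 2 * k) x.
    by rewrite -mulnDr.
  have rec : forall z, num_walks x 8 z + 14 * num_walks x 4 z =
                       7 * num_walks x 6 z + 8 * num_walks x 2 z.
    by move=> z; rewrite -!nth_walk_vector; apply/eqP/rec0; rewrite mem_iota ltn_ord.
  have step := num_walks_recurrence rec (2 * k) x.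
  rewrite -(invE 4) -(invE 2) -(invE 3) -(invE 1) in step.
  by rewrite !(mulnCA _ (1 + n2 + n1 + n0)) -!mulnDr step.
(* All exponents in the recurrence are positive, so the powers of 0 vanish. *)
- by rewrite !expnD !exp1n !(mulnCA n2) exp0n // !mul0n; lia.
- apply/eqP; rewrite -[graph_invariant x k]/(num_walks x (2 * k) x).
  by rewrite -nth_walk_vector; apply: init; rewrite mem_iota.
Qed.

End EdgeLists.

Lemma cycle_graph_edges m :
  [seq (val ((ends e).1 : 'I_m), val ((ends e).2 : 'I_m))
    | e : edge (cycle_graph m) <- enum (edge (cycle_graph m))] =
  [seq (i, i.+1 %% m) | i <- iota 0 m].
Proof. by rewrite -val_enum_ord -map_comp. Qed.

Lemma graph_of_edges_edges n s :
    all (fun p => (p.1 <= n) && (p.2 <= n)) s ->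
  [seq (val ((ends e).1 : 'I_n.+1), val ((ends e).2 : 'I_n.+1))
    | e : edge (graph_of_edges n s) <- enum (edge (graph_of_edges n s))] = s.
Proof.
move/allP => les; rewrite -[RHS](mkseq_nth (0, 0)) /mkseq -val_enum_ord -map_comp.
(* The bounds matter here: [inord] sends a number larger than [n] to 0. *)
apply: eq_map => e /=; have /les/andP[le1 le2] := mem_nth (0, 0) (ltn_ord e).
by rewrite !inordK //; case: nth.
Qed.

(** Running the check at every root replaces an argument by rotational symmetry. *)
Lemma cycle_graph_invariant m n2 n1 n0 (x : 'I_m) :
    all (spectrum_check [seq (i, i.+1 %% m) | i <- iota 0 m] m n2 n1 n0) (iota 0 m) ->
  forall k, (1 + n2 + n1 + n0) * @graph_invariant (cycle_graph m) x k =
            4 ^ k + n2 * 2 ^ k + n1 * 1 ^ k + n0 * 0 ^ k.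
Proof.
move/allP => check; apply: (@graph_invariant_check (cycle_graph m) m id _ (@inj_id _)
  (cycle_graph_edges m)).
by apply: check; rewrite mem_iota ltn_ord.
Qed.

Lemma graph_of_edges_invariant n s n2 n1 n0 (x : 'I_n.+1) :
    all (fun p => (p.1 <= n) && (p.2 <= n)) s ->
    spectrum_check s n.+1 n2 n1 n0 x ->
  forall k, (1 + n2 + n1 + n0) * @graph_invariant (graph_of_edges n s) x k =
            4 ^ k + n2 * 2 ^ k + n1 * 1 ^ k + n0 * 0 ^ k.
Proof.
move=> /graph_of_edges_edges edgesE.
exact: (@graph_invariant_check (graph_of_edges n s) n.+1 id s (@inj_id _) edgesE).
Qed.

(** Leaves are recognized on the edge list, so all leaves are tested as roots and no automorphism of
    the tree is needed. *)
Lemma graph_of_edges_leaf n s n2 n1 n0 (x : 'I_n.+1) :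
    all (fun p => (p.1 <= n) && (p.2 <= n)) s ->
    all (fun i => (size (neighbours s i) == 1) ==> spectrum_check s n.+1 n2 n1 n0 i)
      (iota 0 n.+1) ->
    @leaf (graph_of_edges n s) x ->
  forall k, (1 + n2 + n1 + n0) * @graph_invariant (graph_of_edges n s) x k =
            4 ^ k + n2 * 2 ^ k + n1 * 1 ^ k + n0 * 0 ^ k.
Proof.
move=> les /allP check.
rewrite (@leaf_neighbours (graph_of_edges n s) n.+1 id s (@inj_id _)
  (graph_of_edges_edges les)).
move=> leafx; apply: graph_of_edges_invariant => //.
by apply: (implyP (check _ _)) leafx; rewrite mem_iota ltn_ord.
Qed.

End GraphWalks.

(** * Fixed points of permutations *)

Section FixedPoints.
Local Open Scope group_scope.

(* A list representation of permutations on which statements about 'S_4 can be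
   checked by computation; elements of 'S_4 themselves do not reduce. *)
Definition perm_code (g : 'S_4) : seq nat := [seq val (g i) | i <- enum 'I_4].

Definition code_fixed (s : seq nat) : nat :=
  count (fun i => nth 0 s i == i) (iota 0 4).

(** The product [g * h] applies [g] first, so the second code is read at the entries of the
    first. *)
Definition code_mul (s t : seq nat) : seq nat := [seq nth 0 t i | i <- s].

Lemma nth_perm_code g (i : 'I_4) : nth 0 (perm_code g) i = g i.
Proof. by rewrite (nth_map i) ?nth_ord_enum // size_enum_ord. Qed.

Lemma perm_code_inj : injective perm_code.
Proof.
by move=> g h eq_gh; apply/permP => i; apply: val_inj; rewrite /= -!nth_perm_code eq_gh.
Qed.

Lemma code_fixedE g : code_fixed (perm_code g) = num_fixed g.
Proof.
rewrite /code_fixed -val_enum_ord count_map /num_fixed cardsE cardE.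
rewrite enumT [enum _]/enum_mem size_filter; apply: eq_count => i /=.
by rewrite nth_perm_code.
Qed.

Lemma perm_codeM g h : perm_code (g * h) = code_mul (perm_code g) (perm_code h).
Proof.
rewrite /code_mul -map_comp; apply: eq_map => i /=.
by rewrite nth_perm_code permM.
Qed.

Lemma perm_code1 : perm_code 1 = iota 0 4.
Proof. by rewrite -val_enum_ord; apply: eq_map => i; rewrite perm1. Qed.

Lemma perm_code_mem g : perm_code g \in permutations (iota 0 4).
Proof.
rewrite mem_permutations -val_enum_ord /perm_code.
rewrite (map_comp val g); apply: perm_map; apply: uniq_perm.
- by rewrite map_inj_uniq ?enum_uniq //; apply: perm_inj.
- exact: enum_uniq.
by move=> i; rewrite mem_enum; apply/mapP; exists (g^-1 i); rewrite ?permKV ?mem_enum.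
Qed.

(** The 24 codes are distinct and lie in a list of length 24, so they exhaust it. *)
Lemma count_perm_code (P : pred (seq nat)) :
  #|[set g | P (perm_code g)]| = count P (permutations (iota 0 4)).
Proof.
have codes : perm_eq [seq perm_code g | g : 'S_4] (permutations (iota 0 4)).
  have uniq_codes : uniq [seq perm_code g | g : 'S_4].
    by rewrite map_inj_uniq ?enum_uniq //; apply: perm_code_inj.
  have sub_codes : {subset [seq perm_code g | g : 'S_4] <= permutations (iota 0 4)}.
    by move=> _ /mapP[g _ ->]; apply: perm_code_mem.
  have [|_ codesE] := uniq_min_size uniq_codes sub_codes.
    by rewrite size_permutations ?iota_uniq // size_map -cardE card_Sn.
  exact: uniq_perm (permutations_uniq _) codesE.
rewrite -(seq.permP codes) count_map cardE enumT [enum _]/enum_mem size_filter.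
by apply: eq_count => g /=; rewrite inE.
Qed.

Definition fix_count (G : {set 'S_4}) (j : nat) : nat :=
  #|[set g in G | num_fixed g == j]|.

(** A permutation fixing three of the four points fixes the last one too; the claim is tested on all
    codes. *)
Lemma num_fixed_values g :
  (num_fixed g \in [:: 0; 1; 2; 4]%N) && ((num_fixed g == 4) == (g == 1)).
Proof.
rewrite -(inj_eq perm_code_inj) perm_code1 -code_fixedE.
by move: (perm_code g) (perm_code_mem g); apply/allP; vm_compute.
Qed.

Lemma sum_num_fixed (G : {group 'S_4}) (F : nat -> nat) :
  (\sum_(g in G) F (num_fixed g) =
   F 4 + fix_count G 2 * F 2 + fix_count G 1 * F 1 + fix_count G 0 * F 0)%N.
Proof.
have fixE j :
    (fix_count G j * F j = \sum_(g in G) if num_fixed g == j then F j else 0)%N.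
  by rewrite -big_mkcondr -sum_nat_const; apply: eq_bigl => g; rewrite inE.
have oneE : (F 4 = \sum_(g in G) if g == 1%g then F 4 else 0)%N.
  rewrite -big_mkcondr (big_pred1 1%g) // => g /=.
  by case: eqP => [->|]; rewrite ?group1 ?andbF.
rewrite {1}oneE !fixE -!big_split /=; apply: eq_bigr => g _.
have /andP[] := num_fixed_values g; rewrite !inE.
by case/or4P => /eqP -> /eqP <-; rewrite /= ?addn0.
Qed.

Lemma card_fix_count (G : {group 'S_4}) :
  (#|G| = 1 + fix_count G 2 + fix_count G 1 + fix_count G 0)%N.
Proof. by rewrite -sum1_card (sum_num_fixed G (fun=> 1%N)) !muln1. Qed.

Lemma fix_count_eq0 (G : {group 'S_4}) j :
  (forall g, g \in G -> g != 1 -> num_fixed g != j) -> j != 4 -> fix_count G j = 0.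
Proof.
move=> nfix j4; apply/eqP; rewrite cards_eq0; apply/eqP/setP => g; rewrite !inE.
apply/andP => -[Gg /eqP fixg]; have /andP[_ /eqP] := num_fixed_values g.
rewrite fixg (negPf j4) => /esym/negbT g1.
by have := nfix g Gg g1; rewrite fixg eqxx.
Qed.

(** A permutation with exactly one fixed point is a 3-cycle, whose eighth power is not 1. *)
Lemma fix_count1_2group (G : {group 'S_4}) :
  (#|G| %| 8)%N -> fix_count G 1 = 0.
Proof.
move=> G8; apply: fix_count_eq0 => // g Gg _; have : g ^+ 8 == 1.
  by rewrite -order_dvdn (dvdn_trans (order_dvdG Gg)).
rewrite (expgM g 2 4) (expgM _ 2 2) !expgS !expg0 !mulg1.
rewrite -(inj_eq perm_code_inj) !perm_codeM perm_code1 -code_fixedE.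
by apply/implyP; move: (perm_code g) (perm_code_mem g); apply/allP; vm_compute.
Qed.

(** A generator is a 4-cycle, and no nontrivial power of a 4-cycle has a fixed point. *)
Lemma Z4_fix_count (G : {group 'S_4}) : is_Z4 G -> fix_count G 2 = 0.
Proof.
case=> /cyclicP[g ->]; rewrite -orderE => og.
have g4 : g ^+ 4 == 1 by rewrite -order_dvdn og.
have g2 : g ^+ 2 != 1 by rewrite -order_dvdn og.
apply: fix_count_eq0 => // _ /cyclePmin[i lti ->] gi.
have {lti gi} : i \in [:: 1; 2; 3]%N.
  by move: lti gi; rewrite og; case: i => [|[|[|[|]]]]; rewrite ?expg0 ?eqxx.
move: g4 g2; rewrite !inE -(inj_eq perm_code_inj) -(inj_eq perm_code_inj (g ^+ 2)).
move=> g4 g2 /or3P ci; rewrite -code_fixedE; move: g4 g2.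
have /implyP P :
    (perm_code (g ^+ 4) == perm_code 1) && (perm_code (g ^+ 2) != perm_code 1) ==>
    [&& code_fixed (perm_code (g ^+ 1)) != 2%N,
        code_fixed (perm_code (g ^+ 2)) != 2%N
      & code_fixed (perm_code (g ^+ 3)) != 2%N].
  rewrite !expgS !expg0 !mulg1 !perm_codeM perm_code1.
  by move: (perm_code g) (perm_code_mem g); apply/allP; vm_compute.
by move=> g4 g2; have /and3P[? ? ?] := P (introT andP (conj g4 g2)); case: ci => /eqP ->.
Qed.

(** Both nontrivial elements satisfy [g ^+ 3 = 1], hence are 3-cycles and fix exactly one point. *)
Lemma Z3_fix_count (G : {group 'S_4}) : is_Z3 G -> fix_count G 1 = 2.
Proof.
move=> G3; have := card_fix_count G; rewrite G3.
have nfix j : j \in [:: 0; 2]%N -> fix_count G j = 0.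
  move=> j02; apply: fix_count_eq0 => [g Gg g1|]; last by case/or3P: j02 => // /eqP ->.
  have := order_dvdG Gg; rewrite G3 order_dvdn => g3.
  have : code_fixed (perm_code g) == 1%N; last first.
    by rewrite code_fixedE => /eqP ->; case/or3P: j02 => // /eqP ->.
  move: g3 g1; rewrite !expgS expg0 mulg1 -!(inj_eq perm_code_inj) !perm_codeM perm_code1.
  move=> s3 s1; move: (conj s3 s1) => /andP; apply/implyP.
  by move: {s3 s1} (perm_code g) (perm_code_mem g); apply/allP; vm_compute.
by rewrite (nfix 2) ?(nfix 0) //; lia.
Qed.

Lemma setT_fix_count j :
  fix_count [set: 'S_4] j = count (fun s => code_fixed s == j) (permutations (iota 0 4)).
Proof.
rewrite -count_perm_code; apply: eq_card => g; rewrite !inE.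
by rewrite code_fixedE.
Qed.

Lemma stabilizer_fix_count (G : {group 'S_4}) (i : 'I_4) j :
    G :=: [set g : 'S_4 | g i == i] ->
  fix_count G j = count (fun s => (nth 0 s i == i) && (code_fixed s == j))
                    (permutations (iota 0 4)).
Proof.
move=> ->; rewrite -count_perm_code; apply: eq_card => g; rewrite !inE.
by rewrite code_fixedE nth_perm_code.
Qed.

Lemma S3_fix_count (G : {group 'S_4}) :
  is_S3 G -> [/\ fix_count G 2 = 3, fix_count G 1 = 2 & fix_count G 0 = 0].
Proof.
case=> i Gi; rewrite !(stabilizer_fix_count _ Gi).
by case: i {Gi} => [] [|[|[|[|]]]] //= _; vm_compute.
Qed.

(** The right-hand number is the total number of fixed points, that is [#|G|] times the multiplicity
    [c_1], which is an integer by definition. *)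
Lemma Burnside_dvd (R : realType) (G : {group 'S_4}) :
  (#|G| %| 4 + 2 * fix_count G 2 + fix_count G 1)%N.
Proof.
apply/dvdnP; exists (group_invariant R G 1); rewrite [RHS]mulnC group_invariantE.
by rewrite (sum_num_fixed G (expn^~ 1%N)) !expn1; lia.
Qed.

Lemma tperm_num_fixed (x y : 'I_4) : x != y -> num_fixed (tperm x y) = 2.
Proof.
move=> xy; have -> : num_fixed (tperm x y) = #|~: [set x; y]|.
  apply: eq_card => i; rewrite !inE; case: tpermP => [->|->|/eqP/negPf-> /eqP/negPf->].
  - by rewrite eq_sym (negPf xy) eqxx.
  - by rewrite (negPf xy) eqxx orbT.
  by rewrite eqxx.
by rewrite cardsCs finset.setCK card_ord cards2 xy.
Qed.

(** The elements with two fixed points are the six transpositions; a subgroup containing all of them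
    is the full group, of order 24. *)
Lemma fix_count2_le5 (G : {group 'S_4}) : #|G| < 24 -> fix_count G 2 < 6.
Proof.
rewrite ltnNge => G24; rewrite ltnNge; apply/negP => n2; case/negP: G24.
have eq2 : [set g in G | num_fixed g == 2] = [set g in [set: 'S_4] | num_fixed g == 2].
  apply/eqP; rewrite eqEcard; apply/andP; split.
    by apply/fintype.subsetP => g; rewrite !inE => /andP[].
  by rewrite -/(fix_count _ _) setT_fix_count.
suff /subset_leq_card : [set: 'S_4] \subset G by rewrite cardsT card_Sn.
rewrite -(gen_tperm ord0) gen_subG; apply/fintype.subsetP => _ /imsetP[x _ ->].
have [->|x0] := eqVneq x ord0; first by rewrite tperm1 group1.
have : tperm ord0 x \in [set g in [set: 'S_4] | num_fixed g == 2].
  by rewrite !inE tperm_num_fixed // eq_sym.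
by rewrite -eq2 inE => /andP[].
Qed.

(** Writing n2 for the count, 8 divides 4 + 2 n2 and n2 is at most 7, which leaves 2 and 6; the
    value 6 would give all transpositions. *)
Lemma D4_fix_count (R : realType) (G : {group 'S_4}) : is_D4 G -> fix_count G 2 = 2.
Proof.
move=> G8; have := card_fix_count G; have /dvdnP[k] := Burnside_dvd R G.
by have := @fix_count2_le5 G; rewrite fix_count1_2group G8 //; lia.
Qed.

(** All eight 3-cycles are even, because their cube is 1. Three nontrivial elements remain, and 12
    divides 12 + 2 n2, which forces n2 = 0. *)
Lemma A4_fix_count (R : realType) (G : {group 'S_4}) :
  is_A4 G -> [/\ fix_count G 2 = 0, fix_count G 1 = 8 & fix_count G 0 = 3].
Proof.
move=> GA; have G12 : #|G| = 12.
  by apply/eqP; rewrite -(eqn_pmul2l (isT : 0 < 2)) GA card_Alt ?card_ord.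
have n1 : fix_count G 1 = 8.
  (* The number 8 is traded for the count over the whole symmetric group, so that it suffices to
     show that every element with one fixed point lies in [G]. *)
  rewrite -[RHS]/(count (fun s => code_fixed s == 1%N) (permutations (iota 0 4))).
  rewrite -setT_fix_count; apply: eq_card => g; rewrite !inE GA.
  apply: andb_id2r => /eqP fg.
  have g3 : g ^+ 3 == 1.
    have : num_fixed g == 1%N by rewrite fg.
    rewrite -code_fixedE -(inj_eq perm_code_inj) !expgS expg0 mulg1 !perm_codeM perm_code1.
    by apply/implyP; move: (perm_code g) (perm_code_mem g); apply/allP; vm_compute.
  rewrite Alt_even; have := congr1 (fun s : {perm _} => odd_perm s) (eqP g3).
  by rewrite !expgS expg0 mulg1 !odd_permM odd_perm1; case: odd_perm.
have := card_fix_count G; have := Burnside_dvd R G; rewrite G12 n1.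
by case/dvdnP => k; split; lia.
Qed.

End FixedPoints.

(** * Measures *)

Section Measures.
Local Open Scope classical_set_scope.
Local Open Scope ring_scope.

(** * Means of finitely many probability measures *)

Section AverageProbability.
Local Open Scope ereal_scope.
Context d (T : measurableType d) (R : realType).
Variables (P : nat -> probability T R) (n : nat).

(** The mean has [n.+1] terms, so that the denominator is never 0. *)
Definition average_prob : set T -> \bar R :=
  mscale ((n.+1%:R^-1 : R)%:nng)%R (msum P n.+1).

HB.instance Definition _ := Measure.on average_prob.

Lemma average_probE A :
  average_prob A = (n.+1%:R^-1)%R%:E * \sum_(i < n.+1) P i A.
Proof. by []. Qed.

Let average_prob_setT : average_prob [set: T] = 1.
Proof.
rewrite average_probE; under eq_bigr do rewrite probability_setT.
rewrite sumEFin sumr_const card_ord -EFinM -(mulr_natl 1%R) mulr1.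
by rewrite mulVf // pnatr_eq0.
Qed.

HB.instance Definition _ :=
  Measure_isProbability.Build _ _ _ average_prob average_prob_setT.

Lemma ge0_integral_average_prob (D : set T) (f : T -> \bar R) :
    measurable D -> measurable_fun D f -> (forall x, D x -> 0 <= f x) ->
  \int[average_prob]_(x in D) f x =
  (n.+1%:R^-1)%R%:E * \sum_(i < n.+1) \int[P i]_(x in D) f x.
Proof.
move=> mD mf f0; rewrite /average_prob ge0_integral_mscale //.
by congr (_ * _); rewrite ge0_integral_measure_sum.
Qed.

Lemma average_prob1 A : (forall i, P i A = 1) -> average_prob A = 1.
Proof.
move=> PA; rewrite average_probE; under eq_bigr do rewrite PA.
rewrite -[RHS]average_prob_setT average_probE.
by under [in RHS]eq_bigr do rewrite probability_setT.
Qed.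

End AverageProbability.

(** * Sets of full measure *)

Section FullMeasure.
Local Open Scope ereal_scope.
Context d (T : measurableType d) (R : realType) (m : probability T R).

Lemma probability_setC0 (D : set T) : measurable D -> m D = 1 -> m (~` D) = 0.
Proof. by move=> mD mD1; rewrite probability_setC // mD1 subee. Qed.

Lemma ae_eq_full (D : set T) (f g : T -> \bar R) :
    measurable D -> m D = 1 -> (forall x, D x -> f x = g x) ->
  forall E, ae_eq m E f g.
Proof.
move=> mD mD1 fg E; exists (~` D); split; first exact: measurableC.
  exact: probability_setC0.
by move=> x /= nfg Dx; apply: nfg => _; apply: fg.
Qed.

Lemma integral_full (D : set T) (f : T -> \bar R) :
    measurable D -> m D = 1 -> measurable_fun setT f ->
  \int[m]_x f x = \int[m]_(x in D) f x.
Proof.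
move=> mD mD1 mf; rewrite [RHS]integral_mkcond; apply: ae_eq_integral => //.
  by apply/(measurable_restrictT _ mD); apply: measurable_funS mf.
by apply: (ae_eq_full mD mD1) => x Dx; rewrite patchE mem_set.
Qed.

Lemma probability_setI_full (D A : set T) :
  measurable D -> measurable A -> m D = 1 -> m (A `&` D) = m A.
Proof.
move=> mD mA mD1; rewrite -(integral_indic m mD mA) -(integral_full mD mD1).
  by rewrite integral_indic // setIT.
by apply/measurable_EFinP; apply: measurable_indic.
Qed.

Lemma probability_null_setC (A N : set T) :
  measurable A -> measurable N -> m N = 0 -> ~` A `<=` N -> m A = 1.
Proof.
move=> mA mN mN0 AN; have : m (~` A) = 0.
  by apply/eqP; rewrite -measure_le0 -mN0 le_measure ?inE //; apply: measurableC.
rewrite probability_setC // => /eqP; rewrite sube_eq ?fin_num_measure // add0e.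
by move=> /eqP.
Qed.

End FullMeasure.

(** Newton's scheme: a new node is fitted by adding a multiple of the product that vanishes at the
    earlier nodes. *)
Lemma interpolation (F : fieldType) (s : seq F) (f : F -> F) :
  exists p : {poly F}, {in s, forall x, p.[x] = f x}.
Proof.
elim: s => [|y s [p pE]]; first by exists 0.
have [ys|ys] := boolP (y \in s).
  by exists p => x; rewrite inE => /orP[/eqP->|]; apply: pE.
pose w := \prod_(z <- s) ('X - z%:P); have wy : w.[y] != 0.
  by rewrite -rootE root_prod_XsubC.
exists (p + ((f y - p.[y]) / w.[y]) *: w) => x; rewrite inE hornerD hornerZ.
case/orP => [/eqP->|xs]; first by rewrite divfK // addrC subrK.
have /eqP -> : w.[x] == 0 by rewrite -rootE root_prod_XsubC.
by rewrite mulr0 addr0 pE.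
Qed.

Lemma measurable_seq (R : realType) (s : seq R) : measurable [set` s].
Proof.
elim: s => [|x s IH]; first by rewrite set_nil.
rewrite (_ : [set` x :: s] = [set x] `|` [set` s]).
  by apply: measurableU => //; apply: measurable_set1.
apply/seteqP; split=> y; rewrite /= inE; first by case/orP => [/eqP|]; [left|right].
by case=> [->|->]; rewrite ?eqxx ?orbT.
Qed.

(** * Uniqueness of the spectral measure *)

Section SpectralMeasure.
Local Open Scope ereal_scope.
Variable R : realType.
Implicit Types (m : probability R R) (c : nat -> nat) (p : {poly R}).
Local Notation D := (`[0%R, 4%R]%classic : set R).

Lemma integrable_monomial m (k : nat) : m.-integrable D (fun x => (x ^+ k)%:E).
Proof.
apply: measurable_bounded_integrable => //.
  by rewrite (le_lt_trans (probability_le1 _ _)) ?ltry.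
exists (4 ^+ k)%R; split; first exact: num_real.
move=> y My x /=; rewrite in_itv /= => /andP[x0 x4].
by rewrite (le_trans _ (ltW My)) // ger0_norm ?exprn_ge0 // lerXn2r ?nnegrE.
Qed.

(** The right-hand side involves only [c], so two spectral measures of the same sequence integrate
    polynomials equally. *)
Lemma integral_spectral_poly c m p : is_spectral_measure c m ->
  \int[m]_(x in D) (p.[x])%:E = \sum_(i < size p) (p`_i)%:E * (c i)%:R%:E.
Proof.
move=> [mD1 mc]; under eq_integral do rewrite horner_coef -sumEFin.
rewrite integral_sum //.
  apply: eq_bigr => i _; under eq_integral do rewrite EFinM.
  rewrite integralZl //; last exact: integrable_monomial.
  rewrite -mc (@integral_full _ _ _ _ D) //; apply/measurable_EFinP.
  exact: (@exprn_measurable R _ i).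
by move=> i; apply: (integrableZl _ p`_i (integrable_monomial m i)).
Qed.

Lemma spectral_support c m m' (s : seq R) :
    is_spectral_measure c m -> is_spectral_measure c m' ->
  m' [set` s] = 1 -> m [set` s] = 1.
Proof.
(* Squaring makes the polynomial nonnegative and keeps its zero set equal to [s]. *)
move=> cm cm' m's; pose p : {poly R} := ((\prod_(a <- s) ('X - a%:P)) ^+ 2)%R.
have p0 x : (p.[x] == 0)%R = (x \in s).
  by rewrite horner_exp expf_eq0 /= -rootE root_prod_XsubC.
have mp E : measurable_fun E (fun x => (p.[x])%:E).
  by apply/measurable_EFinP; apply: measurable_poly.
have : \int[m]_(x in D) `|(p.[x])%:E| = 0.
  transitivity (\int[m']_(x in D) (p.[x])%:E); last first.
    rewrite -(integral0 m' D); apply: ae_eq_integral => //.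
    apply: (ae_eq_full (measurable_seq s) m's) => x /= xs; congr EFin.
    by apply/eqP; rewrite p0.
  rewrite (integral_spectral_poly _ cm') -(integral_spectral_poly _ cm).
  by apply: eq_integral => x _; rewrite gee0_abs // lee_fin horner_exp sqr_ge0.
move/ae_eq_integral_abs => /(_ _ (mp _)) [//|N [mN mN0 pN]].
have [mD1 _] := cm.
(* A point outside [s] either lies in [D], where [p] is nonzero and [N] catches it, or lies outside
   [D]. *)
apply: (@probability_null_setC _ _ _ _ _ (N `|` ~` D)) => //.
- exact: measurable_seq.
- by apply: measurableU => //; apply: measurableC.
- by rewrite measureU0 ?mN0 //; [apply: measurableC | apply: probability_setC0].
move=> x /= xs; have [Dx|] := pselect (D x); last by right.
left; apply: pN => /= /(_ Dx) [/eqP]; rewrite p0; exact: xs.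
Qed.

(** Both measures live on [s], where the indicator of [A] agrees with an interpolating polynomial;
    the measure of [A] is therefore a combination of moments. *)
Lemma spectral_eq c m m' (s : seq R) :
    is_spectral_measure c m -> is_spectral_measure c m' -> m' [set` s] = 1 ->
  forall A, measurable A -> m A = m' A.
Proof.
move=> cm cm' m's A mA; have ms := spectral_support cm cm' m's.
have [q qA] := interpolation s (fun x => \1_A x).
suff mAE mu : is_spectral_measure c mu -> mu [set` s] = 1 ->
    mu A = \int[mu]_(x in D) (q.[x])%:E.
  rewrite (mAE m) // (mAE m') //.
  by rewrite (integral_spectral_poly _ cm) (integral_spectral_poly _ cm').
move=> [mu1 _] mus; rewrite -(probability_setI_full _ mA mu1) // -integral_indic //.
apply: ae_eq_integral => //.
- by apply/measurable_EFinP; apply: measurable_indic.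
- by apply/measurable_EFinP; apply: measurable_poly.
by apply: (ae_eq_full (measurable_seq s) mus) => x /= xs; rewrite qA.
Qed.
End SpectralMeasure.

(** Repetitions are allowed because the four points listing a fiber may coincide. *)
Lemma counting_seq (T : choiceType) (R : realType) (s : seq T) :
  counting [set` s] = (size (undup s))%:R%:E :> \bar R.
Proof.
rewrite /counting asboolT //; congr (_%:R%:E); apply: perm_size.
apply: uniq_perm; rewrite ?undup_uniq ?fset_uniq // => x.
rewrite mem_undup [LHS](in_fset_set (finite_seq s)).
by apply/idP/idP; rewrite inE.
Qed.

Lemma setI_seq (T : eqType) (A : set T) (s : seq T) :
  A `&` [set` s] = [set` [seq x <- s | x \in A]].
Proof.
apply/seteqP; split => x /=; rewrite mem_filter; first by case=> /mem_set ->.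
by case/andP => /set_mem.
Qed.

(** * Pullback to the unit circle *)

Section PullBack.

Variable R : realType.
Implicit Types (x : R) (z : R * R).

Lemma unit_circleE z : unit_circle z <-> z.1 ^+ 2 + z.2 ^+ 2 = 1.
Proof.
rewrite /unit_circle /= normc_def /=; split => [[]|->]; last by rewrite sqrtr1.
move/(congr1 (fun x => x ^+ 2)); rewrite expr1n sqr_sqrtr //.
by rewrite addr_ge0 ?sqr_ge0.
Qed.

Lemma phiE z : phi z = 4 * z.1 ^+ 2.
Proof.
by case: z => a b; rewrite /phi /to_complex expr2 /=; ring.
Qed.

(* For x = 0 and x = 4 these four points coincide in pairs, so their mean is the
   uniform distribution on the fiber of x for every x in [0, 4]. *)
Definition point_of_quadrant (i : nat) x : R * R :=
  ((-1) ^+ odd i * (Num.sqrt x / 2), (-1) ^+ (1 < i)%N * Num.sqrt (1 - x / 4)).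

Lemma measurable_point_of_quadrant i :
  measurable_fun setT (point_of_quadrant i).
Proof.
have msqrt : measurable_fun setT (@Num.sqrt R).
  by apply: continuous_measurable_fun; apply: sqrt_continuous.
apply: measurable_fun_pair; apply: measurable_funM => //.
  by apply: measurable_funM.
apply: measurableT_comp => //; apply: measurable_funB => //.
exact: measurable_funM.
Qed.

HB.instance Definition _ i :=
  isMeasurableFun.Build _ _ R (R * R)%type (point_of_quadrant i)
    (measurable_point_of_quadrant i).

Lemma point_of_quadrant_fiber i x : 0 <= x <= 4 -> fiber x (point_of_quadrant i x).
Proof.
move=> /andP[x0 x4]; have y0 : 0 <= 1 - x / 4 by lra.
split; last by rewrite /= phiE /= exprMn sqrr_sign mul1r expr_div_n sqr_sqrtr //; lra.
by apply/unit_circleE; rewrite /= !exprMn !sqrr_sign !mul1r exprVn !sqr_sqrtr //; lra.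
Qed.

Lemma fiberE x : 0 <= x <= 4 ->
  fiber x = [set` [seq point_of_quadrant i x | i <- iota 0 4]].
Proof.
move=> /andP[x0 x4]; have y0 : 0 <= 1 - x / 4 by lra.
apply/seteqP; split => [z [/unit_circleE z1 /= ]|z].
  rewrite phiE => zx; have z1E : z.1 ^+ 2 = (Num.sqrt x / 2) ^+ 2.
    by rewrite expr_div_n sqr_sqrtr //; lra.
  have z2E : z.2 ^+ 2 = Num.sqrt (1 - x / 4) ^+ 2 by rewrite sqr_sqrtr //; lra.
  (* Each coordinate is known up to sign, and the four choices of signs are the four quadrants. *)
  move/eqP: z1E; move/eqP: z2E; rewrite !eqf_sqr.
  rewrite !inE /point_of_quadrant /= !(expr0, expr1, mul1r, mulN1r).
  rewrite [z]surjective_pairing !xpair_eqE /=.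
  by case/orP => /eqP -> /orP[]/eqP ->; rewrite !eqxx ?orbT.
by case/mapP => i _ ->; apply: point_of_quadrant_fiber; rewrite x0.
Qed.

Lemma fiber_proportion (A : set (R * R)) x : 0 <= x <= 4 ->
  fine (counting (A `&` fiber x) : \bar R) / fine (counting (fiber x) : \bar R) =
  4^-1 * \sum_(i < 4) \1_A (point_of_quadrant i x).
Proof.
move=> x04; rewrite fiberE //; set s := map _ _.
rewrite setI_seq !counting_seq -filter_undup /= !big_ord_recl big_ord0 /=.
have [/andP[x0 x4] y0] : 0 <= x <= 4 /\ 0 <= 1 - x / 4 by split=> //; lra.
rewrite {}/s /point_of_quadrant /= !(expr0, expr1, mul1r, mulN1r).
(* This identity excludes [a = b = 0]. If just one of them is 0, the fiber has two points, each
   listed twice, and the proportion is unchanged. *)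
have : (Num.sqrt x / 2) ^+ 2 + Num.sqrt (1 - x / 4) ^+ 2 = 1.
  by rewrite expr_div_n !sqr_sqrtr //; lra.
move: (Num.sqrt x / 2) (Num.sqrt (1 - x / 4)) => a b.
rewrite size_filter !indicE !inE !xpair_eqE !eqxx ![_ == - _]eq_sym !eqNr.
have [->|a0] := eqVneq a 0; have [->|b0] := eqVneq b 0;
  by rewrite ?oppr0 ?andbF ?andbT ?orbF /= => ab1; rewrite ?addn0 ?natrD; lra.
Qed.

Definition pullback_prob (mu : probability R R) : probability (R * R)%type R :=
  average_prob (fun i => distribution mu (point_of_quadrant i)) 3.

Lemma measurable_unit_circle : measurable (@unit_circle R).
Proof.
pose sqnorm z : R := z.1 ^+ 2 + z.2 ^+ 2.
have -> : @unit_circle R = sqnorm @^-1` [set 1%R].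
  by apply/seteqP; split => z /unit_circleE.
rewrite -[_ @^-1` _]setTI; suff mf : measurable_fun setT sqnorm.
  by apply: mf => //; apply: measurable_set1.
by apply: measurable_funD; apply: measurable_funX.
Qed.

(** On [0, 4] the fiber proportion is the mean of the indicators of the four preimages of [A], and
    integrating these gives the four image measures. *)
Lemma pullback_probP (mu : probability R R) :
  mu `[0, 4]%classic = 1%E -> is_pullback mu (pullback_prob mu).
Proof.
move=> mu1; split=> [|A mA].
  apply: average_prob1 => i; rewrite /= /distribution /pushforward.
  apply: (@probability_null_setC _ _ _ mu _ (~` `[0, 4]%classic)).
  - rewrite -[X in measurable X]setTI; apply: measurable_point_of_quadrant => //.
    exact: measurable_unit_circle.
  - exact: measurableC.
  - exact: probability_setC0.
  apply: subsetC => x; rewrite /= in_itv /= => x04.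
  by have [] := point_of_quadrant_fiber i x04.
have mP i : measurable (point_of_quadrant i @^-1` A).
  by rewrite -[X in measurable X]setTI; apply: measurable_point_of_quadrant.
pose f i x : \bar R := (\1_(point_of_quadrant i @^-1` A) x)%:E.
transitivity (\int[mu]_(x in `[0%R, 4%R]) (4^-1%:E * \sum_(i < 4) f i x))%E; last first.
  apply: eq_integral => x; rewrite inE /= in_itv /= => x04.
  by rewrite fiber_proportion // EFinM -sumEFin.
have mf i E : measurable_fun E (f i) by apply/measurable_EFinP/measurable_indic.
rewrite ge0_integralZl_EFin //; last 2 first.
- by move=> x _; apply: sume_ge0 => i _; rewrite lee_fin.
- by apply: emeasurable_sum => i.
rewrite ge0_integral_sum //; last by move=> i x _; rewrite lee_fin.
rewrite [LHS]average_probE; congr (_ * _)%E; apply: eq_bigr => i _.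
rewrite integral_indic //.
exact/esym/(probability_setI_full (measurable_itv _) (mP i) mu1).
Qed.

Lemma average_dirac_spectral (v : nat -> nat) n c :
    (forall i, v i <= 4)%N ->
    (forall k, n.+1 * c k = \sum_(i < n.+1) v i ^ k)%N ->
  is_spectral_measure c
    (average_prob (fun i => dirac ((v i)%:R : R) : probability R R) n).
Proof.
move=> v4 cE; set mu := average_prob _ n.
have vD i : ((v i)%:R : R) \in `[0, 4].
  by rewrite in_itv /= ler0n (ler_nat _ _ 4) v4.
have mu1 : mu `[0%R, 4%R]%classic = 1%E.
  by apply: average_prob1 => i; rewrite /= diracE mem_set //; apply: vD.
have mX k E : measurable_fun E (fun x : R => (x ^+ k)%:E).
  by apply/measurable_EFinP; apply: (@exprn_measurable R _ k).
split=> // k; rewrite (integral_full (measurable_itv _) mu1) //.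
rewrite ge0_integral_average_prob //; last first.
  by move=> x; rewrite /= in_itv /= lee_fin => /andP[x0 _]; apply: exprn_ge0.
under eq_bigr => i _.
  rewrite integral_dirac //= diracE mem_set ?mul1e -?natrX; last exact: vD.
  over.
by rewrite sumEFin -EFinM -natr_sum -cE natrM mulKf.
Qed.

End PullBack.

End Measures.

(** * Comparison *)

Section SameInvariants.
Variables (R : realType) (G : {group 'S_4}).

(** The finite support is recorded because [spectral_eq] requires it of one of the two measures. *)
Lemma group_spectral_measure : exists2 mu : probability R R,
  is_spectral_measure (group_invariant R G) mu &
  mu [set` [seq (i%:R : R)%R | i <- iota 0 5]]%classic = 1%E.
Proof.
pose fixs := [seq num_fixed g | g <- enum G].
have le4 i : (nth 0%N fixs i <= 4)%N.
  (* The bound is required for all [i]; past the end of the list the default value 0 satisfies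
     it. *)
  have [lti|gei] := ltnP i (size fixs); last by rewrite nth_default.
  have /mapP[g _ ->] := mem_nth 0%N lti.
  by rewrite (leq_trans (max_card _)) ?card_ord.
(* The predecessor of [#|G|] appears because the mean over index [n] has [n.+1] terms. *)
exists (average_prob
  (fun i => dirac ((nth 0%N fixs i)%:R : R)%R : probability R R) #|G|.-1).
  apply: average_dirac_spectral => // k.
  rewrite prednK ?cardG_gt0 // group_invariantE.
  rewrite -[in RHS](big_mkord xpredT (fun i => nth 0%N fixs i ^ k)%N).
  rewrite cardE -(size_map num_fixed) -(big_nth 0%N xpredT (fun j => j ^ k)%N).
  by rewrite big_map big_enum.
have fixS i : ((nth 0%N fixs i)%:R : R)%R \in [seq (i%:R : R)%R | i <- iota 0 5].
  by apply: (map_f (fun j => j%:R : R)%R); rewrite mem_iota ltnS le4.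
by apply: average_prob1 => i; rewrite /= diracE mem_set //; apply: fixS.
Qed.

Lemma same_invariants_of_eq (X : multigraph) (x : vertex X) :
  (forall k, graph_invariant x k = group_invariant R G k) -> same_invariants R x G.
Proof.
(* After this substitution both sequences are that of the group, so only existence and uniqueness of
   its measures remain. *)
move=> eqc; rewrite /same_invariants (funext eqc : graph_invariant x = _).
have [mu0 cmu0 mu0s] := group_spectral_measure.
have eq_mu m A :
    is_spectral_measure (group_invariant R G) m -> measurable A -> m A = mu0 A.
  by move=> cm; apply: spectral_eq cm cmu0 mu0s A.
split=> //; split.
- by exists mu0.
- by exists mu0.
- by move=> m m' cm cm' A mA; rewrite !eq_mu.
- by exists (pullback_prob mu0); exists mu0 => //; apply: pullback_probP; case: cmu0.
- by exists (pullback_prob mu0); exists mu0 => //; apply: pullback_probP; case: cmu0.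
move=> eps eps' [mu cmu [_ epsE]] [mu' cmu' [_ epsE']] A mA.
(* The pullback formula expresses both values as integrals of one function, against measures that
   both agree with [mu0]. *)
rewrite epsE // epsE' //; apply: eq_measure_integral => B mB _.
by transitivity (mu0 B); [apply: eq_mu | apply/esym/eq_mu].
Qed.

(** Both sequences are compared after multiplication by the group order, which is
    [1 + n2 + n1 + n0]; the 1 stands for the identity. *)
Lemma same_invariants_of_counts (X : multigraph) (x : vertex X) n2 n1 n0 :
    [/\ fix_count G 2 = n2, fix_count G 1 = n1 & fix_count G 0 = n0] ->
    (forall k, (1 + n2 + n1 + n0) * graph_invariant x k =
               4 ^ k + n2 * 2 ^ k + n1 * 1 ^ k + n0 * 0 ^ k)%N ->
  same_invariants R x G.
Proof.
move=> [<- <- <-] graphE; apply: same_invariants_of_eq => k.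
apply/eqP; rewrite -(eqn_pmul2l (cardG_gt0 G)) group_invariantE.
by rewrite (sum_num_fixed G (expn^~ k)) -graphE -card_fix_count.
Qed.

End SameInvariants.

Theorem theorem10p2 (R : realType) (G : {group 'S_4}) :
  (is_Z1 G -> forall x : vertex (Atilde 1), same_invariants R x G) /\
  (is_Z2 G -> forall x : vertex (Atilde 3), same_invariants R x G) /\
  (is_Z3 G -> forall x : vertex (Atilde 5), same_invariants R x G) /\
  (is_V G -> forall x : vertex (Atilde 7), same_invariants R x G) /\
  (is_Z4 G -> forall x : vertex Dtilde4, leaf x -> same_invariants R x G) /\
  (is_D4 G -> forall x : vertex Dtilde6, leaf x -> same_invariants R x G) /\
  (is_D1 G -> same_invariants R (inord 0 : vertex Dtilde6) G) /\
  (is_S3 G -> forall x : vertex Etilde7,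
     x \in [:: inord 3; inord 6] -> same_invariants R x G) /\
  (is_A4 G -> forall x : vertex Etilde6, leaf x -> same_invariants R x G) /\
  (is_S4 G -> forall x : vertex Etilde7,
     x \in [:: inord 4; inord 7] -> same_invariants R x G).
Proof.
have cardG := card_fix_count G.
have fix0 j : j != 4%N -> (forall g, g \in (G^#)%g -> num_fixed g != j) ->
    fix_count G j = 0%N.
  by move=> j4 nfix; apply: fix_count_eq0 => // g Gg g1; apply: nfix; rewrite !inE g1.
(* Where three numbers are passed explicitly, they count the elements with 2, 1 and 0 fixed points;
   a count not found directly follows from the group order through [cardG]. *)
do 9?apply: conj.
- move=> G1 x; apply: (@same_invariants_of_counts _ _ _ _ 0 0 0).
    by move: cardG; rewrite (G1 : G :=: _) cards1; split; lia.
  by apply: (@cycle_graph_invariant 2); vm_compute.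
- move=> [G2 nfix] x; apply: (@same_invariants_of_counts _ _ _ _ 0 0 1).
    have n2 : fix_count G 2 = 0%N by apply: fix0 => // g /nfix ->.
    have n1 : fix_count G 1 = 0%N by apply: fix0 => // g /nfix ->.
    by split; lia.
  by apply: (@cycle_graph_invariant 4); vm_compute.
- move=> G3 x; apply: (@same_invariants_of_counts _ _ _ _ 0 2 0).
    have n1 := Z3_fix_count G3; rewrite (G3 : #|G| = 3%N) in cardG.
    by split; lia.
  by apply: (@cycle_graph_invariant 6); vm_compute.
- move=> [_ G4 cardV] x; apply: (@same_invariants_of_counts _ _ _ _ 2 0 1).
    have n1 : fix_count G 1 = 0%N by apply: fix_count1_2group; rewrite G4.
    have n2 : fix_count G 2 = 2%N.
      rewrite -[RHS]cardV; apply: eq_card => g; rewrite !inE.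
      (* The two sets can differ only at the identity, which belongs to neither since it has four
         fixed points. *)
      have [->|//] := eqVneq g 1%g; rewrite group1 /=.
      by have /andP[_] := num_fixed_values 1%g; rewrite eqxx => /eqP/eqP ->.
    by split; lia.
  by apply: (@cycle_graph_invariant 8); vm_compute.
- move=> G4 x leafx; apply: (@same_invariants_of_counts _ _ _ _ 0 0 3).
    have n2 := Z4_fix_count G4; have [_ cG] := G4.
    have n1 : fix_count G 1 = 0%N by apply: fix_count1_2group; rewrite cG.
    by split; lia.
  by apply: graph_of_edges_leaf leafx; vm_compute.
- move=> G8 x leafx; apply: (@same_invariants_of_counts _ _ _ _ 2 0 5).
    have n2 := D4_fix_count R G8; have cG : #|G| = 8%N := G8.
    have n1 : fix_count G 1 = 0%N by apply: fix_count1_2group; rewrite cG.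
    by split; lia.
  by apply: graph_of_edges_leaf leafx; vm_compute.
- move=> [G2 nfix]; apply: (@same_invariants_of_counts _ _ _ _ 1 0 0).
    have n0 : fix_count G 0 = 0%N by apply: fix0 => // g /nfix ->.
    have n1 : fix_count G 1 = 0%N by apply: fix0 => // g /nfix ->.
    by split; lia.
  by apply: graph_of_edges_invariant; rewrite ?inordK.
- move=> /S3_fix_count counts x; rewrite !inE => x36.
  apply: same_invariants_of_counts counts _.
  by apply: graph_of_edges_invariant => //; case/orP: x36 => /eqP ->; rewrite inordK.
- move=> GA x leafx; apply: (@same_invariants_of_counts _ _ _ _ 0 8 3).
    exact: (A4_fix_count R GA).
  by apply: graph_of_edges_leaf leafx; vm_compute.
(* Six transpositions, eight 3-cycles, and nine elements without fixed point: three double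
   transpositions and six 4-cycles. *)
move=> GS x; rewrite !inE => x47; apply: (@same_invariants_of_counts _ _ _ _ 6 8 9).
  by rewrite (GS : G :=: _) !setT_fix_count; vm_compute.
by apply: graph_of_edges_invariant => //; case/orP: x47 => /eqP ->; rewrite inordK.
Qed.
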